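(* Let $0<a<b\le 1$, $0<s<1$ and $q\ge 1$. Then $$\left|A(a^{s},b^{s})-L(a^{s},b^{s})\right|\le \frac{s}{2\,G^{2(s-1)^2}(a,b)}\left(\frac{b-a}{2L(a,b)}\right)^{1-\frac1q}\left(\frac{1}{(s^2-s+1)q}\right)^{\frac1q}$$ $$\times\left[\left\{b^{(s^2-s+1)q}-L\bigl(a^{(s^2-s+1)q},b^{(s^2-s+1)q}\bigr)\right\}^{\frac1q}+\left\{L\bigl(a^{(s^2-s+1)q},b^{(s^2-s+1)q}\bigr)-a^{(s^2-s+1)q}\right\}^{\frac1q}\right]$$ and $$\left|G^{s}(a,b)-L(a^{s},b^{s})\right|\le \frac{s}{2\,G^{(s-1)^2}(a,b)}\left(\frac{b-a}{4L(a,b)}\right)^{1-\frac1q}\left(\frac{1}{(s^2-s+1)q}\right)^{\frac1q}$$ $$\times\left[G\bigl(a^{s},b^{-(s-1)^2}\bigr)\left\{b^{(s^2-s+1)q/2}-L\bigl(a^{(s^2-s+1)q/2},b^{(s^2-s+1)q/2}\bigr)\right\}^{\frac1q}+G\bigl(b^{s},a^{-(s-1)^2}\bigr)\left\{L\bigl(a^{(s^2-s+1)q/2},b^{(s^2-s+1)q/2}\bigr)-a^{(s^2-s+1)q/2}\right\}^{\frac1q}\right].$$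
   Context: For positive real numbers $x,y$: $A(x,y)=\frac{x+y}{2}$ is the arithmetic mean, $G(x,y)=\sqrt{xy}$ is the geometric mean, and, for $x\ne y$, $L(x,y)=\frac{y-x}{\ln y-\ln x}$ is the logarithmic mean. $G^{r}(x,y)$ means $(G(x,y))^{r}$. *)

(* Defs.v *)
From Stdlib Require Import Reals.
Open Scope R_scope.

(* The means are used at positive arguments only, and [log_mean] at distinct
   ones: [Rpower], [ln], [sqrt] and [/] take conventional values elsewhere. *)

Definition arith_mean (x y : R) : R := (x + y) / 2.

Definition geom_mean (x y : R) : R := sqrt (x * y).

Definition log_mean (x y : R) : R := (y - x) / (ln y - ln x).

(* Main.v *)
(** With [X = s ln a] and [Y = s ln b], integration by parts writes both
    quantities as a positive multiple of the difference of two integrals of [t exp (x + t d)] over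
    [0 <= t <= 1]: one starts at [x = X], the other at [x = Y] with [d < 0].
    Both are positive, so their difference is at most their sum, and each is
    estimated by Hoelder's inequality with weight [t]. The prefactors come from
    enlarging the rate [s] to [s^2 - s + 1 = s + (s-1)^2] beforehand, which is
    where [b <= 1] enters. *)

Require Import Defs.
From Stdlib Require Import Reals Lra.
From Coquelicot Require Import Coquelicot.
Open Scope R_scope.

(** * Integrals of exponentials with weight [t] *)

Definition ramp_integral (x d : R) : R := RInt (fun t => t * exp (x + t * d)) 0 1.

Lemma ramp_integral_continuous (x d t : R) :
  continuous (fun t => t * exp (x + t * d)) t.
Proof.
  apply (ex_derive_continuous (fun t => t * exp (x + t * d))).
  auto_derive; trivial.
Qed.

Lemma ramp_integral_correct (x d : R) :
  is_RInt (fun t => t * exp (x + t * d)) 0 1 (ramp_integral x d).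
Proof.
  apply (RInt_correct (V := R_CompleteNormedModule)).
  apply (ex_RInt_continuous (V := R_CompleteNormedModule)).
  intros; apply ramp_integral_continuous.
Qed.

Lemma ramp_integral_pos (x d : R) : 0 < ramp_integral x d.
Proof.
  apply RInt_gt_0; [lra | | intros; apply ramp_integral_continuous].
  intros t Ht; apply Rmult_lt_0_compat; [lra | apply exp_pos].
Qed.

Lemma ramp_integralE (x d : R) : d <> 0 ->
  ramp_integral x d = (exp (x + d) - (exp (x + d) - exp x) / d) / d.
Proof.
  intros Hd; apply is_RInt_unique.
  set (F := fun t => exp (x + t * d) * (t / d - 1 / (d * d))).
  replace (_ / d) with (minus (F 1) (F 0)).
  - apply (is_RInt_derive (V := R_CompleteNormedModule) F).
    + intros t _; unfold F; auto_derive; trivial; field; trivial.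
    + intros t _; apply ramp_integral_continuous.
  - unfold F, minus, plus, opp; simpl.
    rewrite Rmult_1_l, Rmult_0_l, Rplus_0_r; field; trivial.
Qed.

Lemma ramp_integral_le (e x d x' d' : R) :
  x <= e + x' -> x + d <= e + x' + d' ->
  ramp_integral x d <= exp e * ramp_integral x' d'.
Proof.
  intros H0 H1.
  refine (is_RInt_le _ _ 0 1 _ _ _ (ramp_integral_correct x d)
    (is_RInt_scal _ 0 1 (exp e) _ (ramp_integral_correct x' d')) _); [lra |].
  intros t Ht; change (t * exp (x + t * d) <= exp e * (t * exp (x' + t * d'))).
  replace (exp e * _) with (t * exp (e + (x' + t * d'))) by (rewrite exp_plus; ring).
  apply Rmult_le_compat_l; [lra |].
  destruct (Req_dec (x + t * d) (e + (x' + t * d'))) as [-> | Hne]; [lra |].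
  left; apply exp_increasing; nra.
Qed.

(** * Hoelder's inequality with weight [t] *)

Lemma exp_young (q y : R) : 1 <= q -> exp y <= / q * exp (q * y) + (1 - / q).
Proof.
  intros Hq.
  assert (Hp : 0 < / q <= 1).
  { split; [apply Rinv_0_lt_compat; lra |].
    rewrite <- Rinv_1; apply Rinv_le_contravar; lra. }
  (* Both points lie above the tangent of [exp] at [y]. *)
  assert (tangent : forall z, exp y * (1 + (z - y)) <= exp z).
  { intros z; replace (exp z) with (exp y * exp (z - y))
      by (rewrite <- exp_plus; f_equal; ring).
    apply Rmult_le_compat_l; [left; apply exp_pos | apply exp_ineq1_le]. }
  pose proof (tangent (q * y)) as H1; pose proof (tangent 0) as H0.
  rewrite exp_0 in H0.
  (* With weights [/ q] and [1 - / q] the points [q * y] and [0] average to [y], so the linear terms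
     of the tangents cancel. *)
  apply Rle_trans with
    (/ q * (exp y * (1 + (q * y - y))) + (1 - / q) * (exp y * (1 + (0 - y)))).
  - right; field; lra.
  - nra.
Qed.

Lemma is_RInt_ramp : is_RInt (fun t => t) 0 1 (/ 2).
Proof.
  replace (/ 2) with (minus (1 * 1 / 2) (0 * 0 / 2))
    by (unfold minus, plus, opp; simpl; field).
  apply (is_RInt_derive (V := R_CompleteNormedModule) (fun t => t * t / 2)).
  - intros t _; auto_derive; trivial; field.
  - intros t _; apply continuous_id.
Qed.

(** The measure [t dt] on the unit interval has mass [/ 2], whence the first factor. Integrating
    Young's inequality for a normalised integrand covers [q = 1] without a separate case. *)
Lemma ramp_integral_holder (q x d : R) : 1 <= q ->
  ramp_integral x d <=
  Rpower (/ 2) (1 - 1 / q) * Rpower (ramp_integral (q * x) (q * d)) (1 / q).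
Proof.
  intros Hq.
  set (J := ramp_integral (q * x) (q * d)).
  assert (HJ : 0 < J) by apply ramp_integral_pos.
  (* The normalisation making Young's inequality sharp: [exp (q N) = 2 J]. *)
  set (N := ln (2 * J) / q).
  assert (HN : exp (- (q * N)) * J = / 2).
  { unfold N; replace (q * _) with (ln (2 * J)) by (field; lra).
    rewrite exp_Ropp, exp_ln by lra; field; lra. }
  assert (HI : exp (- N) * ramp_integral x d <=
               / q * exp (- (q * N)) * J + (1 - / q) * / 2).
  { refine (is_RInt_le _ _ 0 1 _ _ _
      (is_RInt_scal _ 0 1 (exp (- N)) _ (ramp_integral_correct x d))
      (is_RInt_plus _ _ 0 1 _ _
        (is_RInt_scal _ 0 1 (/ q * exp (- (q * N))) _
           (ramp_integral_correct (q * x) (q * d)))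
        (is_RInt_scal _ 0 1 (1 - / q) _ is_RInt_ramp)) _); [lra |].
    intros t Ht.
    change (exp (- N) * (t * exp (x + t * d)) <=
      / q * exp (- (q * N)) * (t * exp (q * x + t * (q * d))) + (1 - / q) * t).
    pose proof (exp_young q (- N + (x + t * d)) Hq) as HY.
    replace (q * (- N + (x + t * d)))
      with (- (q * N) + (q * x + t * (q * d))) in HY by ring.
    rewrite !exp_plus in HY; rewrite <- (exp_plus x) in HY.
    rewrite <- (exp_plus (q * x)) in HY.
    apply (Rmult_le_compat_l t) in HY; lra. }
  (* The two terms of the bound now add up to [/ 2], and [exp N] is the [1 / q] power of [2 * J]. *)
  replace (/ q * exp (- (q * N)) * J) with (/ q * / 2) in HI by (rewrite <- HN; ring).
  replace (Rpower _ _ * _) with (exp N * / 2).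
  - apply Rmult_le_reg_l with (exp (- N)); [apply exp_pos |].
    rewrite <- Rmult_assoc, <- exp_plus, Rplus_opp_l, exp_0; lra.
  - unfold N, Rpower.
    rewrite <- (exp_ln (/ 2)) at 1 by lra.
    rewrite <- !exp_plus, ln_mult, ln_Rinv by lra.
    f_equal; field; lra.
Qed.

(** Rate enlargement and Hoelder combined, in the shape of one summand of the theorem: [y] is split
    into its powers [1 - 1 / q] and [1 / q], and the powers of [k] cancel. For [k = c * q] the
    product [k * y * J] is a gap between a power and a logarithmic mean. *)
Lemma scaled_holder_bound (q k y e x d x' d' : R) :
  1 <= q -> 0 < k -> 0 < y -> x <= e + x' -> x + d <= e + x' + d' ->
  y * ramp_integral x d <=
  exp e * (Rpower (y / 2) (1 - 1 / q) * Rpower (1 / k) (1 / q) *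
           Rpower (k * y * ramp_integral (q * x') (q * d')) (1 / q)).
Proof.
  intros Hq Hk Hy H0 H1.
  pose proof (ramp_integral_le e x d x' d' H0 H1) as Hle.
  pose proof (ramp_integral_holder q x' d' Hq) as Hh.
  set (J := ramp_integral (q * x') (q * d')) in *.
  assert (HJ : 0 < J) by apply ramp_integral_pos.
  replace (Rpower (y / 2) _ * _ * _)
    with (y * (Rpower (/ 2) (1 - 1 / q) * Rpower J (1 / q))).
  - pose proof (exp_pos e) as He.
    apply (Rmult_le_compat_l (exp e)) in Hh; [| lra].
    rewrite <- Rmult_assoc, (Rmult_comm (exp e) y), Rmult_assoc.
    apply Rmult_le_compat_l; lra.
  - unfold Rpower, Rdiv; rewrite !Rmult_1_l.
    rewrite <- (exp_ln y) at 1 by lra.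
    rewrite <- !exp_plus.
    assert (Hky : 0 < k * y) by nra.
    rewrite (ln_mult (k * y)), (ln_mult k), (ln_mult y), !ln_Rinv by lra.
    f_equal; field; lra.
Qed.

(** * Means in logarithmic coordinates *)

Lemma geom_mean_exp (u v : R) : geom_mean (exp u) (exp v) = exp ((u + v) / 2).
Proof.
  unfold geom_mean; rewrite <- exp_plus.
  replace (u + v) with ((u + v) / 2 + (u + v) / 2) at 1 by field.
  rewrite exp_plus; apply sqrt_square; left; apply exp_pos.
Qed.

Lemma log_mean_exp (u v : R) : log_mean (exp u) (exp v) = (exp v - exp u) / (v - u).
Proof. unfold log_mean; rewrite !ln_exp; reflexivity. Qed.

Lemma Rpower_exp (u p : R) : Rpower (exp u) p = exp (p * u).
Proof. unfold Rpower; rewrite ln_exp; reflexivity. Qed.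

(** The logarithmic mean is the average of [exp] between [u] and [v]; integrating
    [exp (u + t * (v - u))] by parts leaves the boundary term [exp v]. The lower gap arises
    likewise, starting from [v]. *)
Lemma upper_gap_ramp (u v : R) : u <> v ->
  exp v - log_mean (exp u) (exp v) = (v - u) * ramp_integral u (v - u).
Proof.
  intros H; rewrite log_mean_exp, ramp_integralE by lra.
  replace (u + (v - u)) with v by ring; field; lra.
Qed.

Lemma lower_gap_ramp (u v : R) : u <> v ->
  log_mean (exp u) (exp v) - exp u = (v - u) * ramp_integral v (u - v).
Proof.
  intros H; rewrite log_mean_exp, ramp_integralE by lra.
  replace (v + (u - v)) with u by ring; field; lra.
Qed.

Lemma arith_log_mean_ramp (u v : R) : u <> v ->
  arith_mean (exp u) (exp v) - log_mean (exp u) (exp v) =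
  (v - u) / 2 * (ramp_integral u (v - u) - ramp_integral v (u - v)).
Proof.
  intros H; unfold arith_mean.
  pose proof (upper_gap_ramp u v H); pose proof (lower_gap_ramp u v H); lra.
Qed.

(** Here the average of [exp] is split at the midpoint. Both integrals run from an endpoint to the
    midpoint, so each integration by parts has boundary term [exp ((u + v) / 2)]. *)
Lemma geom_log_mean_ramp (u v : R) : u <> v ->
  exp ((u + v) / 2) - log_mean (exp u) (exp v) =
  (v - u) / 4 * (ramp_integral u ((v - u) / 2) - ramp_integral v ((u - v) / 2)).
Proof.
  intros H; rewrite log_mean_exp, !ramp_integralE by lra.
  replace (u + (v - u) / 2) with ((u + v) / 2) by field.
  replace (v + (u - v) / 2) with ((u + v) / 2) by field.
  field; lra.
Qed.

Lemma Rabs_scaled_diff_le (r x y X Y : R) :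
  0 <= r -> 0 <= x <= X -> 0 <= y <= Y -> Rabs (r * (x - y)) <= r * (X + Y).
Proof.
  intros Hr Hx Hy; rewrite Rabs_mult, (Rabs_pos_eq r) by lra.
  apply Rmult_le_compat_l; [lra | apply Rabs_le; lra].
Qed.

Theorem proposition1 (a b s q : R)
  (ha : 0 < a) (hab : a < b) (hb : b <= 1)
  (hs0 : 0 < s) (hs1 : s < 1) (hq : 1 <= q) :
  Rabs (arith_mean (Rpower a s) (Rpower b s) -
        log_mean (Rpower a s) (Rpower b s))
  <= s / (2 * Rpower (geom_mean a b) (2 * (s - 1) ^ 2)) *
     Rpower ((b - a) / (2 * log_mean a b)) (1 - 1 / q) *
     Rpower (1 / ((s ^ 2 - s + 1) * q)) (1 / q) *
     (Rpower (Rpower b ((s ^ 2 - s + 1) * q) -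
              log_mean (Rpower a ((s ^ 2 - s + 1) * q))
                       (Rpower b ((s ^ 2 - s + 1) * q))) (1 / q) +
      Rpower (log_mean (Rpower a ((s ^ 2 - s + 1) * q))
                       (Rpower b ((s ^ 2 - s + 1) * q)) -
              Rpower a ((s ^ 2 - s + 1) * q)) (1 / q))
  /\
  Rabs (Rpower (geom_mean a b) s -
        log_mean (Rpower a s) (Rpower b s))
  <= s / (2 * Rpower (geom_mean a b) ((s - 1) ^ 2)) *
     Rpower ((b - a) / (4 * log_mean a b)) (1 - 1 / q) *
     Rpower (1 / ((s ^ 2 - s + 1) * q)) (1 / q) *
     (geom_mean (Rpower a s) (Rpower b (- (s - 1) ^ 2)) *
      Rpower (Rpower b ((s ^ 2 - s + 1) * q / 2) -
              log_mean (Rpower a ((s ^ 2 - s + 1) * q / 2))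
                       (Rpower b ((s ^ 2 - s + 1) * q / 2))) (1 / q) +
      geom_mean (Rpower b s) (Rpower a (- (s - 1) ^ 2)) *
      Rpower (log_mean (Rpower a ((s ^ 2 - s + 1) * q / 2))
                       (Rpower b ((s ^ 2 - s + 1) * q / 2)) -
              Rpower a ((s ^ 2 - s + 1) * q / 2)) (1 / q)).
Proof.
  assert (Ha : a = exp (ln a)) by (symmetry; apply exp_ln; lra).
  assert (Hb : b = exp (ln b)) by (symmetry; apply exp_ln; lra).
  assert (Hlt : ln a < ln b) by (apply ln_increasing; lra).
  assert (Hv : ln b <= 0).
  { rewrite <- ln_1; destruct hb as [hb | ->]; [left; apply ln_increasing; lra | lra]. }
  (* In the coordinates [u = ln a], [v = ln b] all powers are exponentials, and [b <= 1] survives as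
     [v <= 0]. *)
  revert Hlt Hv Ha Hb; generalize (ln a) (ln b); intros u v Hlt Hv -> ->.
  clear ha hab hb.
  set (m := (s - 1) ^ 2); set (c := s ^ 2 - s + 1).
  assert (Hc : c = s + m) by (unfold c, m; ring).
  assert (Hm : 0 <= m) by apply pow2_ge_0.
  assert (Hmean : (exp v - exp u) / log_mean (exp u) (exp v) = v - u).
  { rewrite log_mean_exp; apply exp_increasing in Hlt as He; field; lra. }
  assert (Hcq : 0 < c * q) by nra.
  assert (Hne : forall k, 0 < k -> k * u <> k * v) by (intros; nra).
  pose proof (fun y e x d x' d' => scaled_holder_bound q (c * q) y e x d x' d' hq Hcq)
    as bound.
  rewrite !Rpower_exp, !geom_mean_exp, !Rpower_exp.
  split.
  - replace ((exp v - exp u) / (2 * log_mean (exp u) (exp v))) with ((v - u) / 2)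
      by (rewrite <- Hmean; unfold Rdiv; rewrite Rinv_mult; ring).
    rewrite arith_log_mean_ramp, upper_gap_ramp, lower_gap_ramp by auto.
    (* The shift is the logarithm of the prefactor [1 / G^(2m)]. Since [c = s + m], the endpoint
       conditions reduce to [m * u <= 0] and [m * v <= 0]. *)
    pose proof (bound (v - u) (- (m * (u + v))) (s * u) (s * v - s * u)
      (c * u) (c * (v - u))) as B1.
    pose proof (bound (v - u) (- (m * (u + v))) (s * v) (s * u - s * v)
      (c * v) (c * (u - v))) as B2.
    replace (2 * m * ((u + v) / 2)) with (m * (u + v)) by field.
    rewrite exp_Ropp in B1, B2.
    replace (q * (c * u)) with (c * q * u) in B1 by ring.
    replace (q * (c * (v - u))) with (c * q * v - c * q * u) in B1 by ring.
    replace (c * q * (v - u)) with (c * q * v - c * q * u) in B1 by ring.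
    replace (q * (c * v)) with (c * q * v) in B2 by ring.
    replace (q * (c * (u - v))) with (c * q * u - c * q * v) in B2 by ring.
    replace (c * q * (v - u)) with (c * q * v - c * q * u) in B2 by ring.
    replace ((s * v - s * u) / 2 *
      (ramp_integral (s * u) (s * v - s * u) - ramp_integral (s * v) (s * u - s * v)))
      with (s / 2 * ((v - u) * ramp_integral (s * u) (s * v - s * u) -
        (v - u) * ramp_integral (s * v) (s * u - s * v))) by field.
    pose proof (ramp_integral_pos (s * u) (s * v - s * u)) as P1.
    pose proof (ramp_integral_pos (s * v) (s * u - s * v)) as P2.
    eapply Rle_trans.
    + apply Rabs_scaled_diff_le; [lra | split; [nra |] ..].
      * apply B1; rewrite ?Hc; nra.
      * apply B2; rewrite ?Hc; nra.
    + right; field; apply Rgt_not_eq, exp_pos.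
  - replace ((exp v - exp u) / (4 * log_mean (exp u) (exp v))) with ((v - u) / 2 / 2)
      by (rewrite <- Hmean; unfold Rdiv; rewrite Rinv_mult; field;
          rewrite log_mean_exp; apply exp_increasing in Hlt as He;
          apply Rgt_not_eq, Rdiv_lt_0_compat; lra).
    replace (s * ((u + v) / 2)) with ((s * u + s * v) / 2) by field.
    rewrite geom_log_mean_ramp, upper_gap_ramp, lower_gap_ramp by (apply Hne; lra).
    (* The shift is the logarithm of [1 / G^m] times the geometric mean standing before each brace.
       The slack is [- m * v] (in [B2], [- m * u]) at [t = 0] and [- m * (u + v) / 2] at the
       midpoint of [u] and [v], reached at [t = 1]. *)
    pose proof (bound ((v - u) / 2) (- (m * ((u + v) / 2)) + (s * u + - m * v) / 2)
      (s * u) ((s * v - s * u) / 2) (c * u / 2) (c * (v - u) / 2)) as B1.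
    pose proof (bound ((v - u) / 2) (- (m * ((u + v) / 2)) + (s * v + - m * u) / 2)
      (s * v) ((s * u - s * v) / 2) (c * v / 2) (c * (u - v) / 2)) as B2.
    rewrite exp_plus, exp_Ropp in B1, B2.
    replace (q * (c * u / 2)) with (c * q / 2 * u) in B1 by field.
    replace (q * (c * (v - u) / 2)) with (c * q / 2 * v - c * q / 2 * u) in B1 by field.
    replace (c * q * ((v - u) / 2)) with (c * q / 2 * v - c * q / 2 * u) in B1 by field.
    replace (q * (c * v / 2)) with (c * q / 2 * v) in B2 by field.
    replace (q * (c * (u - v) / 2)) with (c * q / 2 * u - c * q / 2 * v) in B2 by field.
    replace (c * q * ((v - u) / 2)) with (c * q / 2 * v - c * q / 2 * u) in B2 by field.
    replace ((s * v - s * u) / 4 * (ramp_integral (s * u) ((s * v - s * u) / 2) -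
        ramp_integral (s * v) ((s * u - s * v) / 2)))
      with (s / 2 * ((v - u) / 2 * ramp_integral (s * u) ((s * v - s * u) / 2) -
        (v - u) / 2 * ramp_integral (s * v) ((s * u - s * v) / 2))) by field.
    pose proof (ramp_integral_pos (s * u) ((s * v - s * u) / 2)) as P1.
    pose proof (ramp_integral_pos (s * v) ((s * u - s * v) / 2)) as P2.
    eapply Rle_trans.
    + apply Rabs_scaled_diff_le; [lra | split; [nra |] ..].
      * apply B1; rewrite ?Hc; nra.
      * apply B2; rewrite ?Hc; nra.
    + right; field; apply Rgt_not_eq, exp_pos.
Qed.
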